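(* Let $d,m,N\ge 1$ be integers, let $A_1,\dots,A_d\in\mathbb{R}^{m\times m}$ be constant matrices, and let $A_0\in\mathbb{R}^{m\times m}$ be a constant symmetric positive-definite matrix such that $A_0A_j$ is symmetric for every $j=1,\dots,d$. Let $\bm e_1,\dots,\bm e_N\in\mathbb{Z}^d$, $\delta_x,\delta_t>0$, $\lambda=\delta_x/\delta_t$, $\bm v_k=\lambda\bm e_k=(v_{k1},\dots,v_{kd})$, and let $a_k,b_{kj}$ ($1\le k\le N$, $1\le j\le d$) be real numbers satisfying $$\sum_{k=1}^N a_k=1,\quad \sum_{k=1}^N b_{kj}=0,\quad \sum_{k=1}^N v_{kj}a_k=0,\quad \sum_{k=1}^N v_{kj}b_{ki}=\delta_{ij},\qquad i,j=1,\dots,d.$$ Assume that, for every $k=1,\dots,N$, all eigenvalues of $E_k:=a_kI_m+\sum_{j=1}^d b_{kj}A_j$ are positive. Let $\bm f=(\bm f_1,\dots,\bm f_N)$ be a solution, under periodic boundary conditions, of the source-free lattice Boltzmann method $$\bm f_k(\bm x_\ell+\bm e_k\delta_x,t_{n+1})=\bm f_k(\bm x_\ell,t_n)-\omega(\bm x_\ell,t_n)\left[\bm f_k(\bm x_\ell,t_n)-\bm f_k^{(eq)}(\bm x_\ell,t_n)\right],\qquad k=1,\dots,N,$$ where the relaxation parameter $\omega$ may vary with the grid point and time level. If $0\le\omega(\bm x_\ell,t_n)\le 2$ for all grid points $\bm x_\ell$ and all time levels $t_n$, then for every $n$ $$\|\bm f(t_{n+1})\|_P\le\|\bm f(t_n)\|_P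 .$$
   Context: The scheme approximates the linear hyperbolic system $\partial_tU+\sum_{j=1}^d A_j\partial_{x_j}U=0$ with $U\in\mathbb{R}^m$. The $\bm x_\ell$ are the finitely many nodes of a uniform Cartesian grid of spacing $\delta_x$ in a $d$-dimensional periodic box $\Omega$ (so $\bm x_\ell+\bm e_k\delta_x$ is understood modulo periodicity), $t_{n+1}=t_n+\delta_t$, $\bm f_k(\bm x_\ell,t_n)\in\mathbb{R}^m$, $U(\bm x_\ell,t_n):=\sum_{k=1}^N\bm f_k(\bm x_\ell,t_n)$, and $$\bm f_k^{(eq)}(\bm x_\ell,t_n):=a_kU(\bm x_\ell,t_n)+\sum_{j=1}^d b_{kj}A_jU(\bm x_\ell,t_n)=E_kU(\bm x_\ell,t_n).$$ Under the positivity assumption on the eigenvalues of the $E_k$, each matrix $A_0E_k^{-1}$ is symmetric positive definite, and the weighted $L^2$-norm is defined by $$\|\bm f(t_n)\|_P^2:=\sum_{\bm x_\ell\in\Omega}\sum_{k=1}^N\bm f_k^T(\bm x_\ell,t_n)\,A_0E_k^{-1}\,\bm f_k(\bm x_\ell,t_n).$$ $I_m$ denotes the $m\times m$ identity matrix. *)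

(* Defs.v *)
From HB Require Import structures.
From mathcomp Require Import all_boot all_order all_algebra.
From mathcomp Require Import complex.
From mathcomp Require Import reals.

Set Implicit Arguments.
Unset Strict Implicit.
Unset Printing Implicit Defensive.

Import GRing.Theory Num.Theory.
Local Open Scope ring_scope.

Definition symmetric_posdef (R : realType) (m : nat) (S : 'M[R]_m) : Prop :=
  S^T = S /\ forall x : 'cV[R]_m, x != 0 -> 0 < (x^T *m S *m x) 0 0.

(* The eigenvalues of a real matrix are those of its complexification; in R[i],
   0 < z means that z is real and positive. *)
Definition eigenvalues_positive (R : realType) (m : nat) (S : 'M[R]_m) : Prop :=
  forall z : R[i], eigenvalue (map_mx (@real_complex R) S) z -> 0 < z.

(* Nodes of the periodic grid, with M j + 1 nodes in direction j: the node of
   index x lies at the corner of the box plus dx * x. *)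
Definition node (d : nat) (M : 'I_d -> nat) : finType :=
  {dffun forall j : 'I_d, 'I_(M j).+1}.

(* Translation by e * dx modulo the periods: the addition on 'I_(M j).+1 is
   modulo M j + 1, and Zp1 is the class of 1 there. *)
Definition shift (d : nat) (M : 'I_d -> nat) (x : node M) (e : 'rV[int]_d) :
    node M :=
  [ffun j : 'I_d => x j + Zp1 *~ e 0 j].

Section LatticeBoltzmann.

Variables (R : realType) (d m N : nat).

Definition velocity (dx dt : R) (e : 'I_N -> 'rV[int]_d) (k : 'I_N) : 'rV[R]_d :=
  (dx / dt) *: map_mx intr (e k).

Variables (A : 'I_d -> 'M[R]_m) (a : 'I_N -> R) (b : 'I_N -> 'I_d -> R).

Definition Emx (k : 'I_N) : 'M[R]_m :=
  a k *: 1%:M + \sum_(j < d) b k j *: A j.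

Variable M : 'I_d -> nat.

(* A state is a family of densities at one time level: g k x is the value of
   the k-th density at node x. *)
Definition state : Type := 'I_N -> node M -> 'cV[R]_m.

Definition macro (g : state) (x : node M) : 'cV[R]_m := \sum_(k < N) g k x.

Definition equilibrium (g : state) : state := fun k x =>
  a k *: macro g x + \sum_(j < d) b k j *: (A j *m macro g x).

(* f n is the state at time level t_n. *)
Definition lbm_solution (e : 'I_N -> 'rV[int]_d) (omega : nat -> node M -> R)
    (f : nat -> state) : Prop :=
  forall (n : nat) (k : 'I_N) (x : node M),
    f n.+1 k (shift x (e k)) =
      f n k x - omega n x *: (f n k x - equilibrium (f n) k x).

Definition Pnorm_sq (A0 : 'M[R]_m) (g : state) : R :=
  \sum_(x : node M) \sum_(k < N)
    ((g k x)^T *m (A0 *m invmx (Emx k)) *m g k x) 0 0.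

Definition Pnorm (A0 : 'M[R]_m) (g : state) : R := Num.sqrt (Pnorm_sq A0 g).

End LatticeBoltzmann.

(* Main.v *)
Require Import Defs.
From HB Require Import structures.
From mathcomp Require Import all_boot all_order all_algebra.
From mathcomp Require Import complex.
From mathcomp Require Import reals.
From mathcomp Require Import ring.

(** Write [f_k = E_k U + g_k].  Since [\sum_k E_k = I], the deviations satisfy
    [\sum_k g_k = 0], and collision replaces [g_k] by [(1 - omega) g_k] without
    changing [U].  The weights [W_k = A0 E_k^-1] are chosen so that
    [W_k (E_k U) = A0 U] is the same vector for every [k]; hence the cross terms
    [\sum_k g_k^T W_k (E_k U)] vanish, and the collision lowers the weighted
    energy at each node by
    [omega (2 - omega) \sum_k g_k^T W_k g_k], because
    [1 - (1 - omega)^2 = omega (2 - omega)].  This is nonnegative as soon as each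
    [W_k] is positive semidefinite ([relaxation_dissipates]).
    Streaming only permutes the nodes of the torus, so it preserves the total
    energy.

    The linear algebra lies in the semidefiniteness of [W_k].  It is congruent to
    [A0 E_k], because [E_k^T A0 = A0 E_k].  Write [A0 = T^* T] over the complex
    numbers: then [G = T E_k T^-1] is Hermitian (this is the symmetry of
    [A0 E_k]) and has the eigenvalues of [E_k], which are positive, so
    [G = V^* V] and [A0 E_k = T^* G T = (V T)^* (V T)]
    ([selfadjoint_form_ge0]).  Both factorizations are instances of
    [hermitian_gram]. *)

Set Implicit Arguments.
Unset Strict Implicit.
Unset Printing Implicit Defensive.

Import Order.TTheory GRing.Theory Num.Theory.
Local Open Scope ring_scope.

(** * Hermitian matrices with nonnegative eigenvalues *)

Section Gram.

Variable C : numClosedFieldType.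
Local Open Scope sesquilinear_scope.

Lemma hermsymmxE n (S : 'M[C]_n) : (S \is hermsymmx) = (S == S ^t*).
Proof. by rewrite is_hermitianmxE expr0 scale1r. Qed.

(** The rows of the unitary matrix that diagonalizes a normal matrix are
    eigenvectors. *)
Lemma eigenvalue_spectral_diag n (S : 'M[C]_n) i :
  S \is normalmx -> eigenvalue S (spectral_diag S 0 i).
Proof.
move=> /orthomx_spectralP eqS; apply/eigenvalueP.
exists (row i (spectralmx S)).
  rewrite -row_mul {2}eqS !mulmxA mulmxV ?spectral_unit // mul1mx.
  by rewrite row_mul row_diag_mx -scalemxAl -rowE.
apply: contraTneq (spectral_unit S) => row0; apply/negP => uS.
have := congr1 (mulmx^~ (invmx (spectralmx S))) row0.
rewrite -row_mul mulmxV // mul0mx => /rowP/(_ i)/eqP.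
by rewrite !mxE eqxx oner_eq0.
Qed.

(** With [S = P^* diag(s) P], [P] unitary, the factor is [diag(sqrt s) P].
    The eigenvalues of a Hermitian matrix are real, so only the sign of the real
    ones has to be known. *)
Lemma hermitian_gram n (S : 'M[C]_n) :
  S \is hermsymmx ->
  (forall z, z \is Num.real -> eigenvalue S z -> 0 <= z) ->
  exists T : 'M[C]_n, S = T ^t* *m T.
Proof.
move=> hS eig_ge0; have nS := hermitian_normalmx hS.
set s := spectral_diag S; set P := spectralmx S.
have s_ge0 i : 0 <= s 0 i.
  apply: eig_ge0 (eigenvalue_spectral_diag i nS).
  exact: (mxOverP (hermitian_spectral_diag_real hS)).
have sqrt_real i : (sqrtC (s 0 i))^* = sqrtC (s 0 i).
  by apply: conj_Creal; apply: ger0_real; rewrite sqrtC_ge0.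
exists (diag_mx (\row_i sqrtC (s 0 i)) *m P).
rewrite trmx_mul map_mxM tr_diag_mx map_diag_mx /=.
rewrite {1}(orthomx_spectralP nS) invmx_unitary ?spectral_unitarymx //.
rewrite -/P -/s !mulmxA; congr (_ *m _); rewrite -!mulmxA mulmx_diag.
congr (_ *m diag_mx _).
by apply/rowP => i; rewrite !mxE sqrt_real -expr2 sqrtCK.
Qed.

Lemma gram_form_ge0 n (T : 'M[C]_n) (x : 'cV_n) :
  0 <= (x ^t* *m (T ^t* *m T) *m x) 0 0.
Proof.
have -> : x ^t* *m (T ^t* *m T) *m x = (T *m x) ^t* *m (T *m x).
  by rewrite trmx_mul map_mxM !mulmxA.
rewrite mxE sumr_ge0 // => i _.
by rewrite !mxE mulrC mul_conjC_ge0.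
Qed.

End Gram.

(** * Matrices selfadjoint for a weighted inner product *)

Section Weights.

Variables (R : realType) (m : nat).
Local Open Scope sesquilinear_scope.
Local Notation toC := (map_mx (@real_complex R)).

Lemma conj_toC n p (S : 'M[R]_(n, p)) : (toC S) ^ Num.conj = toC S.
Proof.
by apply/matrixP => i j; rewrite !mxE conj_Creal // complex_real.
Qed.

Lemma tr_toC n p (S : 'M[R]_(n, p)) : (toC S) ^t* = toC S^T.
Proof. by rewrite -map_trmx conj_toC map_trmx. Qed.

Lemma posdef_gram (A0 : 'M[R]_m) :
  symmetric_posdef A0 -> exists T : 'M[R[i]]_m, toC A0 = T ^t* *m T.
Proof.
case=> symA0 posA0; apply: hermitian_gram.
  by rewrite hermsymmxE tr_toC symA0.
move=> z /complex_realP[k ->]; rewrite eigenvalue_map ler0c.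
case/eigenvalueP => v vA v_neq0.
have vT_neq0 : v^T != 0 by rewrite trmx_eq0.
have := posA0 _ vT_neq0.
rewrite trmxK vA -scalemxAl mxE => kv_gt0.
have vv_ge0 : 0 <= (v *m v^T) 0 0.
  by rewrite mxE sumr_ge0 // => i _; rewrite !mxE -expr2 sqr_ge0.
by rewrite leNgt; apply: contraTN kv_gt0 => k_lt0; rewrite -leNgt nmulr_rle0.
Qed.

Lemma posdef_unit (A0 : 'M[R]_m) : symmetric_posdef A0 -> A0 \in unitmx.
Proof.
case=> symA0 posA0; rewrite -row_free_unit -kermx_eq0; apply/rowV0P => v.
move/sub_kermxP => vA; apply/eqP; apply: contraT => v_neq0.
have vT_neq0 : v^T != 0 by rewrite trmx_eq0.
by have := posA0 _ vT_neq0; rewrite trmxK vA mul0mx mxE ltxx.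
Qed.

Lemma eigenvalues_positive_unit (E : 'M[R]_m) :
  eigenvalues_positive E -> E \in unitmx.
Proof.
move=> posE; rewrite -row_free_unit -kermx_eq0.
apply: contraT => kerE; have := posE 0.
rewrite -(rmorph0 (real_complex R)) eigenvalue_map ltxx => -> //.
by rewrite /eigenvalue /eigenspace raddf0 subr0.
Qed.

Lemma selfadjoint_form_ge0 (A0 E : 'M[R]_m) :
  symmetric_posdef A0 -> (A0 *m E)^T = A0 *m E -> eigenvalues_positive E ->
  forall x : 'cV_m, 0 <= (x^T *m (A0 *m E) *m x) 0 0.
Proof.
move=> posA0 symAE posE x.
have [T eqT] := posdef_gram posA0.
have uT : T \in unitmx.
  have := posdef_unit posA0; rewrite -(map_unitmx (real_complex R)) eqT.
  by rewrite unitmx_mul => /andP[].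
have uTs : T ^t* \in unitmx by rewrite map_unitmx unitmx_tr.
pose G := T *m toC E *m invmx T.
have eqG : T ^t* *m G *m T = toC (A0 *m E).
  by rewrite map_mxM eqT /G !mulmxA mulmxKV.
have [||V eqV] := hermitian_gram (S := G).
- rewrite hermsymmxE; apply/eqP.
  apply: (can_inj (mulKmx uTs)); apply: (can_inj (mulmxK uT)).
  rewrite eqG -[in LHS]symAE -tr_toC -eqG.
  by rewrite !trmx_mul !map_mxM !trmxCK mulmxA.
- move=> z _ /eigenvalueP[v vG v_neq0]; apply: ltW; apply: posE.
  apply/eigenvalueP; exists (v *m T).
    by rewrite scalemxAl -vG /G !mulmxA mulmxKV.
  by rewrite mulmx_free_eq0 ?row_free_unit.
have eqVT : (V *m T) ^t* *m (V *m T) = toC (A0 *m E).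
  by rewrite -eqG eqV trmx_mul map_mxM !mulmxA.
have := gram_form_ge0 (V *m T) (toC x).
by rewrite eqVT tr_toC -!map_mxM mxE ler0c.
Qed.

(** The symmetry of [A0 E] reads [A0 = E^-T (A0 E)], so the weight is congruent
    to [A0 E] and inherits its symmetry and its sign. *)
Lemma weight_congruence (A0 E : 'M[R]_m) :
  A0^T = A0 -> (A0 *m E)^T = A0 *m E -> E \in unitmx ->
  A0 *m invmx E = (invmx E)^T *m (A0 *m E) *m invmx E.
Proof.
move=> symA0 symAE uE; rewrite -symAE trmx_mul symA0 mulmxA -trmx_mul.
by rewrite mulmxV // trmx1 mul1mx.
Qed.

Lemma weight_sym (A0 E : 'M[R]_m) :
  A0^T = A0 -> (A0 *m E)^T = A0 *m E -> E \in unitmx ->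
  (A0 *m invmx E)^T = A0 *m invmx E.
Proof.
move=> symA0 symAE uE; rewrite weight_congruence //.
by rewrite !trmx_mul trmxK -trmx_mul symAE mulmxA.
Qed.

Lemma weight_form_ge0 (A0 E : 'M[R]_m) :
  symmetric_posdef A0 -> (A0 *m E)^T = A0 *m E -> eigenvalues_positive E ->
  forall x : 'cV_m, 0 <= (x^T *m (A0 *m invmx E) *m x) 0 0.
Proof.
move=> posA0 symAE posE x; have uE := eigenvalues_positive_unit posE.
rewrite weight_congruence //; last by case: posA0.
have := selfadjoint_form_ge0 posA0 symAE posE (invmx E *m x).
by rewrite trmx_mul !mulmxA.
Qed.

End Weights.

(** * Dissipation by relaxation *)

Section Relaxation.

Variables (R : realType) (m N : nat).

Lemma quad_form_line (W : 'M[R]_m) (p g : 'cV_m) (c : R) : W^T = W ->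
  ((p + c *: g)^T *m W *m (p + c *: g)) 0 0 =
    (p^T *m W *m p) 0 0 + (c *+ 2) * (g^T *m (W *m p)) 0 0
    + c ^+ 2 * (g^T *m W *m g) 0 0.
Proof.
move=> symW.
have cross : (p^T *m W *m g) 0 0 = (g^T *m (W *m p)) 0 0.
  transitivity ((p^T *m W *m g)^T 0 0); first by rewrite [RHS]mxE.
  by rewrite !trmx_mul trmxK symW.
have addE (B D : 'M[R]_1) : (B + D) 0 0 = B 0 0 + D 0 0 by rewrite mxE.
have scaleE (k : R) (B : 'M[R]_1) : (k *: B) 0 0 = k * B 0 0 by rewrite mxE.
have -> : (p + c *: g)^T = p^T + c *: g^T by rewrite linearD linearZ.
rewrite !(mulmxDl, mulmxDr) -!(scalemxAl, scalemxAr).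
by rewrite !(addE, scaleE) cross -[g^T *m W *m p]mulmxA; ring.
Qed.

(** The hypothesis [W k *m p k = q] makes the equilibrium densities see a common
    vector [q], so that the first-order term in the deviations is
    [(\sum_k (f k - p k))^T q = 0]. *)
Lemma relaxation_dissipates (W : 'I_N -> 'M[R]_m) (f p : 'I_N -> 'cV[R]_m)
    (q : 'cV[R]_m) (w : R) :
  (forall k, (W k)^T = W k) ->
  (forall k (x : 'cV_m), 0 <= (x^T *m W k *m x) 0 0) ->
  (forall k, W k *m p k = q) ->
  \sum_k f k = \sum_k p k ->
  0 <= w <= 2 ->
  \sum_k ((f k - w *: (f k - p k))^T *m W k *m (f k - w *: (f k - p k))) 0 0
    <= \sum_k ((f k)^T *m W k *m f k) 0 0.
Proof.
move=> symW posW Wp sum_fp /andP[w_ge0 w_le2].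
pose g k := f k - p k.
have energy c : \sum_k ((p k + c *: g k)^T *m W k *m (p k + c *: g k)) 0 0 =
    \sum_k ((p k)^T *m W k *m p k) 0 0
    + c ^+ 2 * \sum_k ((g k)^T *m W k *m g k) 0 0.
  under eq_bigr => k _ do rewrite quad_form_line // Wp.
  rewrite !big_split /= -!mulr_sumr -[X in _ + _ * X + _]summxE -mulmx_suml.
  by rewrite -linear_sum /= sumrB sum_fp subrr trmx0 mul0mx mxE mulr0 addr0.
have -> : \sum_k ((f k - w *: (f k - p k))^T *m W k
                    *m (f k - w *: (f k - p k))) 0 0 =
    \sum_k ((p k + (1 - w) *: g k)^T *m W k *m (p k + (1 - w) *: g k)) 0 0.
  apply: eq_bigr => k _; rewrite scalerBl scale1r addrA.
  by rewrite [p k + g k]addrC subrK.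
have -> : \sum_k ((f k)^T *m W k *m f k) 0 0 =
    \sum_k ((p k + 1 *: g k)^T *m W k *m (p k + 1 *: g k)) 0 0.
  by apply: eq_bigr => k _; rewrite scale1r /g addrC subrK.
rewrite !energy lerD2l ler_wpM2r ?sumr_ge0 //.
rewrite expr1n -subr_ge0.
have -> : 1 - (1 - w) ^+ 2 = w * (2 - w) by ring.
by rewrite mulr_ge0 // subr_ge0.
Qed.

End Relaxation.

(** * The scheme *)

Section Scheme.

Variables (R : realType) (d m N : nat).
Variables (A : 'I_d -> 'M[R]_m) (a : 'I_N -> R) (b : 'I_N -> 'I_d -> R).

Lemma shift_inj (M : 'I_d -> nat) (e : 'rV[int]_d) :
  injective (fun x : node M => shift x e).
Proof.
move=> x y /ffunP eq_xy; apply/ffunP => j.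
by have := eq_xy j; rewrite !ffunE => /addIr.
Qed.

Lemma equilibriumE (M : 'I_d -> nat) (g : state R m N M) k x :
  equilibrium A a b g k x = Emx A a b k *m macro g x.
Proof.
rewrite /equilibrium /Emx mulmxDl -scalemxAl mul1mx; congr (_ + _).
by rewrite mulmx_suml; apply: eq_bigr => j _; rewrite -scalemxAl.
Qed.

Lemma sum_Emx :
  \sum_k a k = 1 -> (forall j, \sum_k b k j = 0) -> \sum_k Emx A a b k = 1%:M.
Proof.
move=> ha hb; rewrite big_split /= -scaler_suml ha scale1r exchange_big /=.
by rewrite big1 ?addr0 // => j _; rewrite -scaler_suml hb scale0r.
Qed.

Lemma Emx_selfadjoint (A0 : 'M[R]_m) k :
  A0^T = A0 -> (forall j, (A0 *m A j)^T = A0 *m A j) ->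
  (A0 *m Emx A a b k)^T = A0 *m Emx A a b k.
Proof.
move=> symA0 hA; rewrite /Emx mulmxDr -scalemxAr mulmx1 mulmx_sumr.
rewrite linearD linearZ /= symA0 linear_sum /=; congr (_ + _).
by apply: eq_bigr => j _; rewrite -scalemxAr linearZ /= hA.
Qed.

End Scheme.

Theorem theorem4p2 (R : realType) (d m N : nat)
  (hd : (0 < d)%N) (hm : (0 < m)%N) (hN : (0 < N)%N)
  (A : 'I_d -> 'M[R]_m) (A0 : 'M[R]_m)
  (hA0 : symmetric_posdef A0)
  (hA : forall j : 'I_d, (A0 *m A j)^T = A0 *m A j)
  (e : 'I_N -> 'rV[int]_d) (dx dt : R) (hdx : 0 < dx) (hdt : 0 < dt)
  (a : 'I_N -> R) (b : 'I_N -> 'I_d -> R)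
  (ha : \sum_(k < N) a k = 1)
  (hb : forall j : 'I_d, \sum_(k < N) b k j = 0)
  (hva : forall j : 'I_d, \sum_(k < N) velocity dx dt e k 0 j * a k = 0)
  (hvb : forall i j : 'I_d,
     \sum_(k < N) velocity dx dt e k 0 j * b k i = (i == j)%:R)
  (hE : forall k : 'I_N, eigenvalues_positive (Emx A a b k))
  (M : 'I_d -> nat)
  (omega : nat -> node M -> R) (f : nat -> state R m N M)
  (hf : lbm_solution A a b e omega f)
  (homega : forall (n : nat) (x : node M), 0 <= omega n x <= 2) :
  forall n : nat, Pnorm A a b A0 (f n.+1) <= Pnorm A a b A0 (f n).
Proof.
move=> n; have symA0 : A0^T = A0 by case: hA0.
have symAE k := Emx_selfadjoint a b k symA0 hA.
have uE k := eigenvalues_positive_unit (hE k).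
rewrite /Pnorm ler_wsqrtr // /Pnorm_sq.
(* Each velocity has its own shift of the nodes, hence the reindexing under the
   sum over velocities. *)
rewrite exchange_big /=.
under eq_bigr => k _ do rewrite (reindex_inj (@shift_inj d M (e k))) /=.
rewrite exchange_big /=; apply: ler_sum => x _.
under eq_bigr => k _ do rewrite hf.
apply: (relaxation_dissipates (W := fun k => A0 *m invmx (Emx A a b k))
  (f := fun k => f n k x) (p := fun k => equilibrium A a b (f n) k x)
  (q := A0 *m macro (f n) x)).
- by move=> k; apply: weight_sym.
- by move=> k; apply: weight_form_ge0.
- by move=> k; rewrite equilibriumE mulmxA mulmxKV.
- under [RHS]eq_bigr => k _ do rewrite equilibriumE.
  by rewrite -mulmx_suml sum_Emx // mul1mx.
- exact: homega.
Qed.
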